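(* Let $\mathcal U\subset\mathbb R^{n_\xi}$ be convex (and compact), and let $g:\mathcal X\times\mathcal Y\times\mathcal U\to\mathbb R$ be a continuous function such that $\xi\mapsto g(x,y,\xi)$ is concave for every $x\in\mathcal X$, $y\in\mathcal Y$, and which is Lipschitz continuous in $y$ with Lipschitz constant $L>0$, i.e. $|g(x,y,\xi)-g(x,y',\xi)|\le L\|y-y'\|$ for all $x\in\mathcal X$, $\xi\in\mathcal U$, $y,y'\in\mathcal Y$. Furthermore, assume that for every $x\in\mathcal X$ there exist $R$ convex recourse-stable regions $\mathcal D_1,\ldots,\mathcal D_R\subseteq\mathcal U$ (with respect to $x$) such that $\mathrm{cl}(\mathcal D_1)\cup\cdots\cup\mathrm{cl}(\mathcal D_R)=\mathcal U$, where $\mathrm{cl}$ denotes closure. Then, for any positive integer $s$ with $s\le n_\xi+1$ it holds $$\mathrm{opt}(Rs)-\mathrm{opt}(\mathrm{2RO})\le L\,\mathrm{diam}(\mathcal Y)\,\ln\!\left(\frac{n_\xi+1}{s}\right).$$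
   Context: $\mathcal X\subseteq\mathbb R^{n_x}$ is compact, $\mathcal Y\subset\mathbb Z^{n_y}$ is bounded (hence finite), $\mathcal Y(x)\subseteq\mathcal Y$ for each $x\in\mathcal X$, and $\mathcal U$ is nonempty. The function $f$ is $$f(x,y,\xi):=\begin{cases} g(x,y,\xi) & \text{if } A(\xi)x+B(\xi)y\ge h(\xi),\\ \infty & \text{otherwise,}\end{cases}$$ where $A(\xi)\in\mathbb R^{m\times n_x}$, $B(\xi)\in\mathbb R^{m\times n_y}$, $h(\xi)\in\mathbb R^m$ are affine functions of $\xi$. An infimum over the empty set is $+\infty$. For a positive integer $k$, $$\mathrm{opt}(k):=\inf_{\substack{x\in\mathcal X\\ y^1,\ldots,y^k\in\mathcal Y(x)}}\ \sup_{\xi\in\mathcal U}\ \inf_{i=1,\ldots,k} f(x,y^i,\xi),\qquad \mathrm{opt}(\mathrm{2RO}):=\inf_{x\in\mathcal X}\ \sup_{\xi\in\mathcal U}\ \inf_{y\in\mathcal Y(x)} f(x,y,\xi),$$ where the $y^i$ need not be distinct. $\|\cdot\|$ is the Euclidean norm and $\mathrm{diam}(\mathcal Y)=\max_{y,y'\in\mathcal Y}\|y-y'\|$. For given $x\in\mathcal X$, a convex set $\mathcal D\subseteq\mathcal U$ is called recourse-stable if $$\{y\in\mathcal Y(x):\exists\,\xi\in\mathcal D \text{ with } A(\xi)x+B(\xi)y\ge h(\xi)\}=\{y\in\mathcal Y(x):\forall\,\xi\in\mathcal D,\ A(\xi)x+B(\xi)y\ge h(\xi)\}.$$ Standing assumption: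 there are $x\in\mathcal X$ and $y\in\mathcal Y(x)$ with $A(\xi)x+B(\xi)y\ge h(\xi)$ for all $\xi\in\mathcal U$ (so all these optimal values are finite). *)

(* Defs.v *)
From mathcomp Require Import all_boot all_order all_algebra.
From mathcomp Require Import all_classical all_reals all_analysis.
Import Order.TTheory GRing.Theory Num.Theory.
Import numFieldNormedType.Exports.

Set Implicit Arguments.
Unset Strict Implicit.
Unset Printing Implicit Defensive.

Local Open Scope classical_set_scope.
Local Open Scope ring_scope.

(* Vectors are columns over an arbitrary [realType]
   [R]; an integer vector is a real vector with entries in [Num.int], so that
   [Z^n] is literally a subset of [R^n]. *)

(* The library norm on matrices is the max norm, hence this definition. *)
Definition enorm (R : realType) (n : nat) (v : 'cV[R]_n) : R :=
  Num.sqrt (\sum_(i < n) v i ord0 ^+ 2).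

(* For finite nonempty [Y] the supremum is a maximum. *)
Definition diam (R : realType) (n : nat) (Y : set 'cV[R]_n) : R :=
  sup [set enorm (y - y') | y in Y & y' in Y].

Definition is_affine (R : realType) (V W : lmodType R) (F : V -> W) : Prop :=
  exists (T : {linear V -> W}) (c : W), forall v, F v = T v + c.

Definition concave_on (R : realType) (n : nat) (D : set 'cV[R]_n)
    (g : 'cV[R]_n -> R) : Prop :=
  @convex_function R 'cV[R]_n D (fun xi => - g xi).

Section robust.
Context {R : realType} {nx ny nxi m : nat}.
Variables (A : 'cV[R]_nxi -> 'M[R]_(m, nx)) (B : 'cV[R]_nxi -> 'M[R]_(m, ny)).
Variable (h : 'cV[R]_nxi -> 'cV[R]_m).
Variable (g : 'cV[R]_nx -> 'cV[R]_ny -> 'cV[R]_nxi -> R).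
Variables (X : set 'cV[R]_nx) (Yx : 'cV[R]_nx -> set 'cV[R]_ny).
Variable (U : set 'cV[R]_nxi).

Definition feasible (x : 'cV[R]_nx) (y : 'cV[R]_ny) (xi : 'cV[R]_nxi) : Prop :=
  forall i, h xi i ord0 <= (A xi *m x + B xi *m y) i ord0.

Definition cost (x : 'cV[R]_nx) (y : 'cV[R]_ny) (xi : 'cV[R]_nxi) : \bar R :=
  if `[< feasible x y xi >] then (g x y xi)%:E else +oo%E.

Definition opt (k : nat) : \bar R :=
  ereal_inf [set v | exists (x : 'cV[R]_nx) (y : 'I_k -> 'cV[R]_ny),
    [/\ X x, forall i, Yx x (y i) &
      v = ereal_sup [set ereal_inf [set cost x (y i) xi | i in [set: 'I_k]]
                    | xi in U]]].

Definition opt_2RO : \bar R :=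
  ereal_inf [set ereal_sup [set ereal_inf [set cost x y xi | y in Yx x]
                           | xi in U]
            | x in X].

Definition recourse_stable (x : 'cV[R]_nx) (D : set 'cV[R]_nxi) : Prop :=
  [/\ @convex_set R 'cV[R]_nxi D, D `<=` U &
    [set y | Yx x y /\ exists2 xi, D xi & feasible x y xi] =
    [set y | Yx x y /\ forall xi, D xi -> feasible x y xi]].

End robust.

(* Main.v *)
Require Import Defs.
From mathcomp Require Import all_boot all_order all_algebra.
From mathcomp Require Import all_classical all_reals all_analysis.
From mathcomp Require Import zify ring lra.
Import Order.TTheory GRing.Theory Num.Theory.
Import numFieldNormedType.Exports.

(** Fix [x] and a value [v] exceeding the worst-case cost of [x]. On a nonempty
   recourse-stable region [D] the feasible decisions do not depend on [xi], and
   every [xi] in [D] admits a feasible [y] with [g x y xi <= v]. Helly's theorem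
   for the convex sets [{xi in D | g x y xi > v}] leaves at most [nxi + 1]
   decisions with this property, and a minimax argument provides weights
   [p_j], summing to 1, such that [\sum_j p_j g x y_j xi <= v] on [D]. Moving
   the smallest of [k + 1] weights to another decision increases this sum by at
   most [L diam Y / (k + 1)]; repeating this until [s] decisions remain costs at
   most [L diam Y ln ((nxi + 1) / s)]. By continuity the resulting bound extends
   to the closure of [D], and the [N] regions together use [N s] decisions. *)

Local Open Scope classical_set_scope.
Local Open Scope ring_scope.

(** * Helly's theorem and two concave functions *)

Section convexity.
Context {R : realType} {n : nat}.
Local Notation V := 'cV[R]_n.
Implicit Types (K : set V) (f : V -> R) (x y : V) (a b : R).

Lemma convex_setP K : @convex_set R V K <->
  forall x y a b, K x -> K y -> 0 <= a -> 0 <= b -> a + b = 1 ->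
    K (a *: x + b *: y).
Proof.
split=> [cK x y a b Kx Ky a0 b0 ab|cK x y t].
  have a1 : a <= 1 by lra.
  have := cK x y (Itv01 a0 a1) (mem_set Kx) (mem_set Ky).
  by rewrite inE; have -> : b = 1 - a by lra.
rewrite !inE => Kx Ky.
have t0 : 0 <= t%:num by []. have t1 : t%:num <= 1 by [].
by apply: (cK x y t%:num (1 - t%:num)) => //; lra.
Qed.

Lemma concave_onP K f : concave_on K f <->
  forall x y a b, K x -> K y -> 0 <= a -> 0 <= b -> a + b = 1 ->
    a * f x + b * f y <= f (a *: x + b *: y).
Proof.
split=> [cf x y a b Kx Ky a0 b0 ab|cf t x y].
  have a1 : a <= 1 by lra.
  have := cf (Itv01 a0 a1) x y (mem_set Kx) (mem_set Ky).
  have -> : b = 1 - a by lra.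
  rewrite convRE !mulrN -opprD lerN2. exact.
rewrite !inE => Kx Ky.
have t0 : 0 <= t%:num by []. have t1 : t%:num <= 1 by [].
rewrite convRE !mulrN -opprD lerN2.
by apply: (cf x y t%:num (1 - t%:num)) => //; lra.
Qed.

Lemma concave_onS K K' f : K' `<=` K -> concave_on K f -> concave_on K' f.
Proof.
by move=> sK /concave_onP cf; apply/concave_onP => x y a b /sK Kx /sK Ky; exact: cf.
Qed.

Lemma convex_superlevel K f :
  @convex_set R V K -> concave_on K f -> @convex_set R V (K `&` [set x | 0 < f x]).
Proof.
move=> /convex_setP cK /concave_onP cf; apply/convex_setP => x y a b.
move=> [Kx fx] [Ky fy] a0 b0 ab; split; first exact: cK.
apply: lt_le_trans (cf x y a b Kx Ky a0 b0 ab).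
have [a_gt0|a_le0] := ltP 0 a.
  by apply: ltr_wpDr; [apply: mulr_ge0 => //; exact: ltW|exact: mulr_gt0].
have -> : a = 0 by lra.
have -> : b = 1 by lra.
by rewrite mul0r mul1r add0r.
Qed.

Lemma concave_on_sum (J : finType) K (f : J -> V -> R) (p : J -> R) :
  (forall j, 0 <= p j) -> (forall j, concave_on K (f j)) ->
  concave_on K (fun x => \sum_j p j * f j x).
Proof.
move=> p0 cf; apply/concave_onP => x y a b Kx Ky a0 b0 ab.
rewrite !mulr_sumr -big_split /=; apply: ler_sum => j _.
have /concave_onP/(_ x y a b Kx Ky a0 b0 ab) := cf j.
by move/(ler_wpM2l (p0 j)); rewrite mulrDr !(mulrCA (p j)).
Qed.

(** Dividing by the total weight and ignoring points of weight 0 suits the positive and negative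
    parts of an affine dependence, whose weights need not sum to 1. *)
Lemma convex_set_sum (I : Type) (r : seq I) K (w : I -> R) (z : I -> V) :
  @convex_set R V K -> (forall i, 0 <= w i) -> (forall i, 0 < w i -> K (z i)) ->
  0 < \sum_(i <- r) w i ->
  K ((\sum_(i <- r) w i)^-1 *: \sum_(i <- r) w i *: z i).
Proof.
move=> /convex_setP cK w0 Kz.
(* The total may vanish on a tail of [r], so the induction carries that case as an alternative. *)
suff [[-> _]|[]//] : \sum_(i <- r) w i = 0 /\ \sum_(i <- r) w i *: z i = 0 \/
    0 < \sum_(i <- r) w i /\
    K ((\sum_(i <- r) w i)^-1 *: \sum_(i <- r) w i *: z i) by rewrite ltxx.
elim: r => [|i r IH]; first by left; rewrite !big_nil.
rewrite !big_cons; have := w0 i; rewrite le_eqVlt => /orP[/eqP<-|wi].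
  by rewrite !scale0r !add0r.
right; case: IH => [[-> ->]|[]].
  by rewrite !addr0 scalerA mulVf ?gt_eqF// scale1r; split=> //; exact: Kz.
set s := \sum_(j <- r) w j; set u := \sum_(j <- r) _ => s0 Ku.
split; first by rewrite addr_gt0.
have -> : (w i + s)^-1 *: (w i *: z i + u) =
    (w i / (w i + s)) *: z i + (s / (w i + s)) *: (s^-1 *: u).
  rewrite scalerDr !scalerA; congr (_ *: _ + _ *: _); first by rewrite mulrC.
  by field; rewrite !gt_eqF// addr_gt0.
apply: cK => //; [exact: Kz| | |].
- by rewrite divr_ge0// ltW// addr_gt0.
- by rewrite divr_ge0// ltW// addr_gt0.
- by rewrite -mulrDl divff// gt_eqF// addr_gt0.
Qed.

(** The [k] rows [(z i, 1)] have only [n + 1] entries, so a nonzero row vector annihilates their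
    matrix from the left; the column of ones makes its entries sum to 0. *)
Lemma affine_dependence {k : nat} (z : 'I_k -> V) : (n + 1 < k)%N ->
  exists c : 'I_k -> R,
    [/\ exists i, c i != 0, \sum_i c i = 0 & \sum_i c i *: z i = 0].
Proof.
move=> nk.
pose M : 'M[R]_(k, n + 1) := row_mx (\matrix_(i, j) z i j ord0) (const_mx 1).
have : kermx M != 0.
  rewrite kermx_eq0; apply/negP => /eqP rM.
  by have := rank_leq_col M; rewrite rM leqNgt nk.
move=> /rowV0Pn[v /sub_kermxP vM v0]; exists (fun i => v ord0 i).
move: vM; rewrite mul_mx_row -row_mx0 => /eq_row_mx[vz v1]; split.
- apply/existsP; apply: contraR v0 => /existsPn v0; apply/eqP/rowP => i.
  by rewrite mxE; apply/eqP; rewrite -[_ == _]negbK.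
- move/matrixP/(_ ord0 ord0) : v1; rewrite !mxE => v1; rewrite -[RHS]v1.
  by apply: eq_bigr => i _; rewrite mxE mulr1.
- apply/colP => j; move/matrixP/(_ ord0 j) : vz; rewrite !mxE summxE => vz.
  rewrite -[RHS]vz.
  by apply: eq_bigr => i _; rewrite !mxE.
Qed.

(* The common point is the Radon point of the [z i]. *)
Lemma radon_common_point {k : nat} (C : 'I_k -> set V) (z : 'I_k -> V) :
  (n + 1 < k)%N -> (forall i, @convex_set R V (C i)) ->
  (forall i j, j != i -> C j (z i)) -> exists x, forall i, C i x.
Proof.
move=> /(affine_dependence z)[c [[i0 ci0] c0 cz0]] cC Cz.
pose wp i := Num.max (c i) 0; pose wn i := Num.max (- c i) 0.
have cE i : c i = wp i - wn i.
  by rewrite /wp /wn; case: (leP (c i) 0); case: (leP (- c i) 0) => /=; lra.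
have wp0 i : 0 <= wp i by rewrite le_max lexx orbT.
have wn0 i : 0 <= wn i by rewrite le_max lexx orbT.
have sE : \sum_i wp i = \sum_i wn i.
  apply/eqP; rewrite -subr_eq0 -sumrB -[X in _ == X]c0; apply/eqP.
  by apply: eq_bigr => i _; rewrite cE.
have zE : \sum_i wp i *: z i = \sum_i wn i *: z i.
  apply/eqP; rewrite -subr_eq0 -sumrB -[X in _ == X]cz0; apply/eqP.
  by apply: eq_bigr => i _; rewrite cE scalerBl.
have sgt0 : 0 < \sum_i wp i.
  rewrite lt_neqAle sumr_ge0// andbT eq_sym; apply: contra ci0 => /eqP s0.
  have wpi0 := psumr_eq0P (fun i _ => wp0 i) s0 (i := i0) isT.
  rewrite sE in s0; have wni0 := psumr_eq0P (fun i _ => wn0 i) s0 (i := i0) isT.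
  by rewrite cE wpi0 wni0 subrr.
exists ((\sum_i wp i)^-1 *: \sum_i wp i *: z i) => i.
(* If [c i <= 0], every [z j] with [c j > 0] has [j != i] and so lies in [C i]; if [c i > 0], the
   same holds for the expression through [wn]. *)
have [ci|ci] := leP (c i) 0.
  apply: convex_set_sum => // j; rewrite lt_max ltxx orbF => cj; apply: Cz.
  by apply: contraTneq cj => <-; rewrite -leNgt.
rewrite sE zE; apply: convex_set_sum => //; last by rewrite -sE.
move=> j; rewrite lt_max ltxx orbF oppr_gt0 => cj; apply: Cz.
by apply: contraTneq cj => <-; rewrite -leNgt ltW.
Qed.

(** Induction on the size of [S]: an index whose removal leaves no common point is dropped. If there
    is none, each [S :\ j] has a common point, and with more than [n + 1] indices Radon's argument
    yields a point common to all of [S]. *)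
Lemma helly (J : finType) (C : J -> set V) (S : {set J}) :
  (forall j, @convex_set R V (C j)) ->
  ~ (exists x, forall j, j \in S -> C j x) ->
  exists S' : {set J}, [/\ (#|S'| <= n + 1)%N, S' \subset S &
    ~ exists x, forall j, j \in S' -> C j x].
Proof.
move=> cC; have [m] := ubnP #|S|; elim: m S => // m IH S.
have [Sn|nS] := leqP #|S| (n + 1); first by exists S.
move=> Sm CS.
have [[j [jS Cj]]|allj] := pselect (exists j, j \in S /\
    ~ exists x, forall i, i \in S :\ j -> C i x).
  have [|S' [? S'S ?]] := IH _ _ Cj.
    by move: Sm; rewrite (cardsD1 j S) jS.
  by exists S'; split => //; apply: fintype.subset_trans S'S (subD1set _ _).
exfalso; apply: CS.
have zP (i : 'I_#|S|) : exists z, forall j, j \in S :\ enum_val i -> C j z.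
  apply: contrapT => zi; apply: allj; exists (enum_val i).
  by split=> //; exact: enum_valP.
have [z {}zP] := choice zP.
have [i|i j ji|x Cx] := radon_common_point (fun i => C (enum_val i)) z nS.
- exact: cC.
- by apply: zP; rewrite !inE (inj_eq enum_val_inj) ji enum_valP.
- by exists x => j jS; rewrite -(enum_rankK_in jS jS).
Qed.

(** Minimax for two functions. A point with [f2 x > 0] bounds [t] from below by
    [f2 x / (f2 x - f1 x)], one with [f1 x > 0] bounds it from above by [- f2 x / (f1 x - f2 x)];
    concavity keeps all lower bounds below all upper ones. *)
Lemma concave_pair K f1 f2 :
  @convex_set R V K -> concave_on K f1 -> concave_on K f2 ->
  (forall x, K x -> f1 x <= 0 \/ f2 x <= 0) ->
  exists t, [/\ 0 <= t, t <= 1 &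
    forall x, K x -> t * f1 x + (1 - t) * f2 x <= 0].
Proof.
move=> /convex_setP cK /concave_onP cf1 /concave_onP cf2 f12.
(* The lower bounds on [t]; the element 0 keeps the set nonempty if [f2] is never positive. *)
pose E := [set t | t = 0 \/
  exists x, [/\ K x, 0 < f2 x & t = f2 x / (f2 x - f1 x)]].
have f1_le0 x : K x -> 0 < f2 x -> f1 x <= 0.
  by move=> /f12[//|]; rewrite leNgt => /negbTE ->.
have f2_le0 x : K x -> 0 < f1 x -> f2 x <= 0.
  by move=> /f12[|//]; rewrite leNgt => /negbTE ->.
have E0 : E 0 by left.
have E1 : ubound E 1.
  move=> _ [->//|[x [Kx f2x ->]]]; have := f1_le0 x Kx f2x => f1x.
  by rewrite ler_pdivrMr; lra.
have hE : has_sup E by split; [exists 0|exists 1].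
exists (sup E); split; [exact: sup_upper_bound|exact: ge_sup (ex_intro _ _ E0) E1|].
move=> x Kx; have t0 : 0 <= sup E by exact: sup_upper_bound.
have t1 : sup E <= 1 by exact: ge_sup (ex_intro _ _ E0) E1.
have [f2x|f2x] := ltP 0 (f2 x).
  have f1x := f1_le0 x Kx f2x.
  have : f2 x / (f2 x - f1 x) <= sup E.
    by apply: sup_upper_bound => //; right; exists x.
  by rewrite ler_pdivrMr; nra.
have [f1x|f1x] := ltP 0 (f1 x); last by nra.
suff : sup E <= - f2 x / (f1 x - f2 x) by rewrite ler_pdivlMr; nra.
apply: ge_sup; first by exists 0.
move=> _ [->|[y [Ky f2y ->]]]; first by rewrite divr_ge0//; lra.
have f1y := f1_le0 y Ky f2y.
(* Otherwise some point of the segment [x, y] makes both functions positive. *)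
rewrite ler_pdivrMr; last by lra.
rewrite mulrAC ler_pdivlMr; last by lra.
rewrite leNgt; apply/negP => lt12.
(* With the weights [a] and [b], the chords of [f1] and [f2] take the same value
   [(f1 x * f2 y - f2 x * f1 y) / q], positive by [lt12]. *)
pose q := (f1 x - f2 x) + (f2 y - f1 y).
have q0 : 0 < q by rewrite /q; lra.
pose a := (f2 y - f1 y) / q; pose b := (f1 x - f2 x) / q.
have a0 : 0 <= a by rewrite divr_ge0//; lra.
have b0 : 0 <= b by rewrite divr_ge0//; lra.
have ab : a + b = 1 by rewrite /a /b -mulrDl addrC divff// gt_eqF.
have [] := f12 _ (cK x y a b Kx Ky a0 b0 ab); apply/negP; rewrite -ltNge.
  apply: lt_le_trans (cf1 x y a b Kx Ky a0 b0 ab).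
  rewrite /a /b mulrAC [X in _ + X]mulrAC -mulrDl divr_gt0//; nra.
apply: lt_le_trans (cf2 x y a b Kx Ky a0 b0 ab).
rewrite /a /b mulrAC [X in _ + X]mulrAC -mulrDl divr_gt0//; nra.
Qed.

End convexity.

(** * Weights: minimax and sparsification *)

(** Here [p] lives on all of [J] and vanishes off [S], so that sums over different supports are
    directly comparable; a predicate serves both sets and sequences. *)
Definition weights_on {R : realType} {J : finType} (S : pred J) (p : J -> R) :=
  [/\ forall j, 0 <= p j, forall j, ~~ S j -> p j = 0 & \sum_j p j = 1].

Section weights.
Context {R : realType} {J : finType}.
Implicit Types (S : {set J}) (p : J -> R).

Lemma sum_kronecker (F : J -> R) i : \sum_j (j == i)%:R * F j = F i.
Proof.
rewrite (bigD1 i)//= eqxx mul1r big1 ?addr0// => j /negbTE ->.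
by rewrite mul0r.
Qed.

Lemma sum_kronecker1 i : \sum_(j : J) (j == i)%:R = 1 :> R.
Proof.
by rewrite -[RHS](sum_kronecker (fun=> 1) i); apply: eq_bigr => j _; rewrite mulr1.
Qed.

(** Otherwise all terms [p j * (F j - v)] are nonnegative with sum at most 0, which forces [p = 0].
    This turns a bound on an average into a single decision. *)
Lemma weights_on_le {S p} (F : J -> R) (v : R) :
  weights_on (mem S) p -> \sum_j p j * F j <= v -> exists2 j, j \in S & F j <= v.
Proof.
move=> [p0 pS p1] Fv; apply: contrapT => H.
have Fgt j : j \in S -> v < F j.
  by move=> jS; rewrite ltNge; apply/negP => Fj; apply: H; exists j.
have F0 j : 0 <= p j * (F j - v).
  have [jS|jS] := boolP (j \in S); last by rewrite pS// mul0r.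
  by rewrite mulr_ge0// subr_ge0 ltW// Fgt.
have sE : \sum_j p j * (F j - v) = \sum_j p j * F j - v.
  rewrite -[X in _ - X]mul1r -p1 mulr_suml -sumrB.
  by apply: eq_bigr => j _; rewrite mulrBr.
have s0 : \sum_j p j * (F j - v) = 0.
  by apply/le_anti; rewrite sumr_ge0// andbT sE subr_le0.
have pj0 j : p j = 0.
  have [jS|jS] := boolP (j \in S); last by rewrite pS.
  have /eqP := psumr_eq0P (fun j _ => F0 j) s0 (i := j) isT.
  by rewrite mulf_eq0 subr_eq0 => /orP[/eqP//|]; rewrite gt_eqF// Fgt.
by move/eqP: p1; rewrite big1 ?(eq_sym _ 1) ?oner_eq0// => j _.
Qed.

(** Weights all above [1 / #|S|] would sum to more than 1. *)
Lemma light_weight S p : weights_on (mem S) p ->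
  exists2 j, j \in S & p j <= #|S|%:R^-1.
Proof.
move=> [p0 pS p1]; apply: contrapT => H.
have pgt j : j \in S -> #|S|%:R^-1 < p j.
  by move=> jS; rewrite ltNge; apply/negP => pj; apply: H; exists j.
have pS1 : \sum_(j in S) p j = 1.
  by rewrite -p1 [RHS](bigID (mem S))/= [X in _ + X]big1 ?addr0.
have [j jS] : exists j, j \in S.
  apply/set0Pn; apply/eqP => S0; move/eqP: pS1.
  by rewrite S0 big_set0 eq_sym oner_eq0.
suff : 1 < \sum_(j in S) p j by rewrite pS1 ltxx.
have <- : \sum_(j in S) #|S|%:R^-1 = 1 :> R.
  rewrite sumr_const -[_^-1]mulr1 -mulrnAr mulVf// pnatr_eq0.
  by rewrite -lt0n; apply/card_gt0P; exists j.
rewrite (bigD1 j)//= [ltRHS](bigD1 j)//= ltr_leD ?pgt//.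
by apply: ler_sum => i /andP[iS _]; rewrite ltW// pgt.
Qed.

(** This is [ln (1 - t) <= - t] at [t = 1 / (k + 1)], since [(k + 1) / k = 1 / (1 - t)]. *)
Lemma ln_succ_div (k : nat) : (0 < k)%N ->
  k.+1%:R^-1 <= ln (k.+1%:R / k%:R) :> R.
Proof.
move=> k0; have kR0 : 0 < k%:R :> R by rewrite ltr0n.
have xgt : - 1 < - k.+1%:R^-1 :> R.
  by rewrite ltrN2 invf_lt1 ?ltr0n// ltr1n.
have -> : k.+1%:R / k%:R = (1 - k.+1%:R^-1)^-1 :> R.
  by rewrite -natr1; field; rewrite addrK natr1 !pnatr_eq0 /= -lt0n.
by rewrite lnV ?posrE 1?lerNr ?le_ln1Dx// -ltrBlDl sub0r.
Qed.

Variables (T : Type) (K : set T) (f : J -> T -> R) (C : R).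
Hypothesis f_close : forall i j x, K x -> `|f i x - f j x| <= C.

(** The weight of some [b], at most [1 / #|S|], is moved to another point [a], which changes the sum
    by [p b * (f a x - f b x)]. *)
Lemma drop_light_weight S p : (1 < #|S|)%N -> weights_on (mem S) p ->
  exists S' p', [/\ S' \subset S, #|S'| = #|S|.-1, weights_on (mem S') p' &
    forall x, K x ->
      \sum_j p' j * f j x <= \sum_j p j * f j x + C / #|S|%:R].
Proof.
move=> S1 Sp; have [p0 pS p1] := Sp; have [b bS pb] := light_weight _ _ Sp.
have [a] : exists a, a \in S :\ b.
  by apply/card_gt0P; move: S1; rewrite (cardsD1 b S) bS.
rewrite !inE => /andP[ab aS].
pose p' j := p j + (p b * (j == a)%:R - p b * (j == b)%:R).
have sum_p' F : \sum_j p' j * F j = \sum_j p j * F j + p b * (F a - F b).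
  rewrite -(sum_kronecker F a) -(sum_kronecker F b) -sumrB mulr_sumr -big_split.
  by apply: eq_bigr => j _; rewrite /p' /=; ring.
exists (S :\ b), p'; split.
- exact: subD1set.
- by rewrite [in RHS](cardsD1 b S) bS.
- split=> [j|j|].
  + rewrite /p'; have [->|jb] := eqVneq j b.
      by rewrite eq_sym (negbTE ab) mulr0 mulr1 sub0r subrr.
    by rewrite mulr0 subr0 addr_ge0// mulr_ge0.
  + rewrite /p' /= !inE negb_and negbK => /orP[/eqP->|jS].
      by rewrite eqxx eq_sym (negbTE ab) mulr0 mulr1 sub0r subrr.
    rewrite pS// (_ : j == a = false) 1?(_ : j == b = false) ?mulr0 ?subrr ?addr0//.
      by apply/negP => /eqP jb; rewrite jb bS in jS.
    by apply/negP => /eqP ja; rewrite ja aS in jS.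
  + have := sum_p' (fun=> 1); rewrite subrr mulr0 addr0.
    under eq_bigr do rewrite mulr1; under [X in _ = X]eq_bigr do rewrite mulr1.
    by rewrite p1.
- move=> x Kx; rewrite sum_p' lerD2l mulrC.
  have := f_close a b x Kx; have := ler_norm (f a x - f b x) => fab fC.
  have fabC := le_trans fab fC.
  apply: (@le_trans _ _ (C * p b)); first exact: ler_wpM2r.
  by apply: ler_wpM2l => //; exact: le_trans fC.
Qed.

(* Dropping one point of [k + 1] costs [C / (k + 1) <= C * ln ((k + 1) / k)],
   and these costs telescope. *)
Lemma sparsify (s d : nat) S p : (0 < s)%N -> (#|S| <= s + d)%N ->
  weights_on (mem S) p ->
  exists S' p', [/\ S' \subset S, (#|S'| <= s)%N, weights_on (mem S') p' &
    forall x, K x ->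
      \sum_j p' j * f j x <= \sum_j p j * f j x + C * ln ((s + d)%:R / s%:R)].
Proof.
move=> s0; have sR0 : 0 < s%:R :> R by rewrite ltr0n.
elim: d S p => [|d IH] S p Ss Sp.
  exists S, p; split=> //; first by rewrite -(addn0 s).
  by move=> x Kx; rewrite addn0 divff ?gt_eqF// ln1 mulr0 addr0.
have sdR0 : 0 < (s + d)%:R :> R by rewrite ltr0n addn_gt0 s0.
(* If [S] already has at most [s + d] points, nothing is dropped: the bound only grows with [d], as
   [C >= 0]. *)
have [S1|S1] := leqP #|S| (s + d).
  have [S' [p' [S'S S's S'p' H]]] := IH S p S1 Sp; exists S', p'; split=> // x Kx.
  apply: le_trans (H x Kx) _; rewrite lerD2l.
  have C0 : 0 <= C.
    have [j _ _] := light_weight _ _ Sp.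
    by apply: le_trans (f_close j j x Kx).
  apply: ler_wpM2l => //.
  rewrite ler_ln ?posrE ?divr_gt0 ?ltr0n ?addnS ?addn_gt0 ?s0//.
  by rewrite ler_pM2r ?invr_gt0// ler_nat.
have SE : #|S| = (s + d).+1 by apply/eqP; rewrite eqn_leq S1 -addnS Ss.
have [|S1' [p1 [S1S S1card S1p1 H1]]] := drop_light_weight S p _ Sp.
  by rewrite SE ltnS addn_gt0 s0.
have [|S' [p' [S'S S's S'p' H]]] := IH S1' p1 _ S1p1; first by rewrite S1card SE.
exists S', p'; split=> //; first exact: fintype.subset_trans S'S S1S.
move=> x Kx; apply: le_trans (H x Kx) _; apply: le_trans (lerD (H1 x Kx) (lexx _)) _.
rewrite -addrA lerD2l SE.
have C0 : 0 <= C.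
  have [j _ _] := light_weight _ _ Sp.
  by apply: le_trans (f_close j j x Kx).
have -> : (s + d.+1)%:R / s%:R =
    ((s + d).+1%:R / (s + d)%:R) * ((s + d)%:R / s%:R) :> R.
  by rewrite mulrA divfK ?gt_eqF// addnS.
rewrite [X in _ <= _ * X]lnM ?posrE ?divr_gt0 ?ltr0n ?addn_gt0 ?s0//.
rewrite mulrDr lerD2r ler_wpM2l//.
by apply: ln_succ_div; rewrite addn_gt0 s0.
Qed.

End weights.

(* The induction step replaces [K] by the convex set where [f a] is positive and
   merges the weighted sum obtained there with [f a]. *)
Lemma minimax_seq {R : realType} {n : nat} {J : finType} (f : J -> 'cV[R]_n -> R)
    (j0 : J) (r : seq J) (K : set 'cV[R]_n) :
  @convex_set R 'cV[R]_n K -> (forall j, concave_on K (f j)) ->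
  (forall x, K x -> exists2 j, j \in j0 :: r & f j x <= 0) ->
  exists2 p : J -> R, weights_on (mem (j0 :: r)) p &
    forall x, K x -> \sum_j p j * f j x <= 0.
Proof.
elim: r K => [|a r IH] K cK cf Kf.
  exists (fun j => (j == j0)%:R).
    split=> [j|j|]; rewrite ?ler0n//; last exact: sum_kronecker1.
    by rewrite /= inE => /negbTE ->.
  move=> x Kx; rewrite sum_kronecker.
  by have [j] := Kf x Kx; rewrite inE => /eqP ->.
have [|j|x [Kx fa]|p [p0 pr p1] Hp] := IH (K `&` [set x | 0 < f a x]).
- exact: convex_superlevel.
- exact: concave_onS (cf j).
- have [j jr fj] := Kf x Kx; exists j => //; move: jr fj.
  rewrite !inE => /or3P[->//|/eqP ->|-> _]; last by rewrite orbT.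
  by rewrite leNgt fa.
have [x Kx|t [t0 t1 Ht]] :=
    concave_pair K (fun x => \sum_j p j * f j x) (f a) cK
      (concave_on_sum _ _ _ _ p0 cf) (cf a).
  have [fa|fa] := ltP 0 (f a x); last by right.
  by left; apply: Hp.
have u0 : 0 <= 1 - t by rewrite subr_ge0.
have sumE F : \sum_j (t * p j + (1 - t) * (j == a)%:R) * F j =
    t * (\sum_j p j * F j) + (1 - t) * F a.
  rewrite -(sum_kronecker F a) !mulr_sumr -big_split.
  by apply: eq_bigr => j _ /=; ring.
exists (fun j => t * p j + (1 - t) * (j == a)%:R); last first.
  by move=> x Kx; rewrite sumE; exact: Ht.
split=> [j|j|].
- by rewrite addr_ge0// mulr_ge0.
- rewrite /= !inE !negb_or => /and3P[jj0 ja jr].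
  rewrite (negbTE ja) pr ?mulr0 ?addr0//=.
  by rewrite inE negb_or jj0.
- have := sumE (fun=> 1); under eq_bigr do rewrite mulr1.
  by move=> ->; under eq_bigr do rewrite mulr1; rewrite p1; ring.
Qed.

Lemma minimax {R : realType} {n : nat} {J : finType} (f : J -> 'cV[R]_n -> R)
    (S : {set J}) (K : set 'cV[R]_n) :
  @convex_set R 'cV[R]_n K -> (forall j, concave_on K (f j)) -> K !=set0 ->
  (forall x, K x -> exists2 j, j \in S & f j x <= 0) ->
  exists2 p : J -> R, weights_on (mem S) p &
    forall x, K x -> \sum_j p j * f j x <= 0.
Proof.
(* A point of [K] shows that [S] is nonempty; an empty [S] carries no weights. *)
move=> cK cf [x0 Kx0] Kf; case SE : (enum S) => [|j0 r].
  by have [j] := Kf x0 Kx0; rewrite -mem_enum SE.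
have memS j : (j \in j0 :: r) = (j \in S) by rewrite -SE mem_enum.
have [x Kx|p [p0 pS p1] Hp] := minimax_seq f j0 r K cK cf.
  by have [j jS fj] := Kf x Kx; exists j; rewrite ?memS.
by exists p => //; split=> // j jS; apply: pS; rewrite /= memS.
Qed.

(** * Finiteness and continuity *)

Lemma ler_coord_norm {R : realType} {m n : nat} (x : 'M[R]_(m, n)) i j :
  `|x i j| <= `|x|.
Proof.
rewrite [leRHS](_ : _ = mx_norm x)// mx_normrE.
exact: (le_bigmax _ (fun ij => `|x ij.1 ij.2|) (i, j)).
Qed.

(** The entries are integers of absolute value below some [N], so [Y] lies in the image of a finite
    type of functions, the entries being shifted by [N] to become natural numbers. *)
Lemma finite_bounded_int {R : realType} {n : nat} (Y : set 'cV[R]_n) :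
  (forall y, Y y -> forall i, y i ord0 \is a Num.int) -> bounded_set Y ->
  finite_set Y.
Proof.
move=> Yint [M [_ YM]].
(* Boundedness provides a bound only for radii strictly above [M]. *)
pose N := Num.bound (M + 1).
have YN y i : Y y -> `|y i ord0| < N%:R.
  move=> Yy; apply: le_lt_trans (ler_coord_norm y i ord0) _.
  apply: le_lt_trans (unstable.ltr_bound (M + 1)).
  by apply: YM => //; rewrite ltrDl.
pose F (u : {ffun 'I_n -> 'I_(N + N).+1}) : 'cV[R]_n :=
  \col_i ((u i)%:R - N%:R).
apply: (@sub_finite_set _ _ (F @` setT)); last exact: finite_image.
move=> y Yy.
have uP i : exists k : 'I_(N + N).+1, k%:R - N%:R = y i ord0 :> R.
  have /intrP[z yz] := Yint y Yy i; have := YN y i Yy; rewrite yz.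
  rewrite -[N%:R]/(N%:~R) -intr_norm ltr_int => zN.
  have z0 : 0 <= z + N%:Z by lia.
  have zNN : (absz (z + N%:Z)%R < (N + N).+1)%N by lia.
  exists (Ordinal zNN) => /=; rewrite -[_%:R]/((_%:Z)%:~R) gez0_abs//.
  by rewrite intrD addrK.
have [u {}uP] := choice uP.
exists [ffun i => u i] => //; apply/colP => i.
by rewrite mxE ffunE uP.
Qed.

Lemma enorm_le_diam {R : realType} {n : nat} (Y : set 'cV[R]_n) y y' :
  finite_set Y -> Y y -> Y y' -> enorm (y - y') <= diam Y.
Proof.
move=> /finite_seqP[s ->] ys y's; apply: sup_upper_bound; last first.
  by exists y => //; exists y'.
have e0 (z : 'cV[R]_n) : 0 <= enorm z by exact: sqrtr_ge0.
split; first by exists (enorm (y - y')), y => //; exists y'.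
(* The set must be bounded above for [sup] to be an upper bound; the sum of all pairwise distances
   suffices. *)
exists (\sum_(a <- s) \sum_(b <- s) enorm (a - b)) => _ [a /= sa [b /= sb <-]].
rewrite (big_rem a)//= -[leLHS]addr0 lerD ?sumr_ge0// => [|c _]; last exact: sumr_ge0.
by rewrite (big_rem b)//= lerDl sumr_ge0.
Qed.

(** A value above [v] at [t] would persist near [t] within [U], and so occur at a point of [D]. *)
Lemma within_continuous_le_closure {R : realType} {T : topologicalType}
    (U D : set T) (f : T -> R) (v : R) :
  {within U, continuous f} -> D `<=` U -> (forall t, D t -> f t <= v) ->
  forall t, U t -> closure D t -> f t <= v.
Proof.
move=> /subspace_continuousP cf DU fv t Ut Dt.
rewrite leNgt; apply/negP => vt.
have : nbhs (f t) [set r | v < r] by exact: lt_nbhsr.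
move=> /(cf t Ut); rewrite nbhs_filterE /within /= => /Dt[t' [Dt' /= H]].
by have := H (DU _ Dt'); rewrite ltNge fv.
Qed.

Lemma affine_continuous_coord {R : realType} {n p q : nat}
    (F : 'cV[R]_n -> 'M[R]_(p, q)) i j :
  is_affine F -> continuous (fun x => F x i j).
Proof.
move=> [T [c FE]].
have -> : (fun x => F x i j) =
    (fun x => (\sum_k x k ord0 * T (delta_mx k ord0) i j) + c i j).
  apply/funext => x; rewrite FE mxE; congr (_ + _).
  rewrite [x in LHS]matrix_sum_delta linear_sum summxE; apply: eq_bigr => k _.
  by rewrite big_ord1 linearZ mxE.
have cM k : continuous (fun x : 'cV[R]_n => x k ord0 * T (delta_mx k ord0) i j).
  by move=> x; apply: continuousM; [exact: coord_continuous|exact: cst_continuous].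
have cS : continuous (fun x : 'cV[R]_n => \sum_k x k ord0 * T (delta_mx k ord0) i j).
  by apply: continuous_big => //; exact: add_continuous.
by move=> x; apply: continuousD; [exact: cS|exact: cst_continuous].
Qed.

(** * One recourse-stable region *)

(** Each constraint says that a continuous function of [xi] is at most 0, a closed condition. *)
Lemma feasible_closure {R : realType} {nx ny nxi m : nat}
    (A : 'cV[R]_nxi -> 'M[R]_(m, nx)) (B : 'cV[R]_nxi -> 'M[R]_(m, ny))
    (h : 'cV[R]_nxi -> 'cV[R]_m) x y (D : set 'cV[R]_nxi) :
  is_affine A -> is_affine B -> is_affine h ->
  (forall xi, D xi -> feasible A B h x y xi) ->
  forall xi, closure D xi -> feasible A B h x y xi.
Proof.
move=> A_affine B_affine h_affine AD xi cxi i.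
pose slack xi :=
  h xi i ord0 - \sum_j A xi i j * x j ord0 - \sum_j B xi i j * y j ord0.
have slackE xi' :
    (slack xi' <= 0) = (h xi' i ord0 <= (A xi' *m x + B xi' *m y) i ord0).
  by rewrite /slack !mxE -addrA -opprD subr_le0.
have cslack : continuous slack.
  have cMx p (F : 'cV[R]_nxi -> 'M[R]_(m, p)) (z : 'cV[R]_p) : is_affine F ->
      continuous (fun xi => \sum_j F xi i j * z j ord0).
    move=> aF; apply: continuous_big => [|j _ x']; first exact: add_continuous.
    by apply: continuousM; [exact: affine_continuous_coord|exact: cst_continuous].
  have cAx := cMx _ A x A_affine. have cBy := cMx _ B y B_affine.
  have ch : continuous (fun xi => h xi i ord0) by exact: affine_continuous_coord.
  move=> xi'; exact: continuousB (continuousB (ch xi') (cAx xi')) (cBy xi').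
rewrite -slackE; apply: (@within_continuous_le_closure _ _ setT D) => // [|t /AD].
  exact: continuous_subspaceT.
by rewrite slackE; exact.
Qed.

Lemma within_continuous_sum {R : realType} {T : topologicalType} {J : finType}
    (U : set T) (f : J -> T -> R) (p : J -> R) :
  (forall j, {within U, continuous (f j)}) ->
  {within U, continuous (fun t => \sum_j p j * f j t)}.
Proof.
move=> cf; apply: continuous_big => [|j _ x]; first exact: add_continuous.
by apply: continuousM; [exact: cst_continuous|exact: cf].
Qed.

Lemma within_continuous_slice {T1 T2 T3 T : topologicalType}
    (X : set T1) (Y : set T2) (U : set T3) (g : T1 -> T2 -> T3 -> T) x y :
  {within X `*` Y `*` U, continuous (fun p => g p.1.1 p.1.2 p.2)} ->
  X x -> Y y -> {within U, continuous (g x y)}.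
Proof.
move=> /subspace_continuousP cg Xx Yy; apply/subspace_continuousP => u Uu W.
move=> /(cg (x, y, u) (conj (conj Xx Yy) Uu)) [[P Q] /= [nP nQ] PQ].
rewrite /within /=; apply: filterS nQ => u' Qu' Uu'.
by apply: (PQ (x, y, u')) => //; split=> //; exact: nbhs_singleton.
Qed.

Section region.
Context {R : realType} {nx ny nxi m : nat}.
Context {A : 'cV[R]_nxi -> 'M[R]_(m, nx)} {B : 'cV[R]_nxi -> 'M[R]_(m, ny)}.
Context {h : 'cV[R]_nxi -> 'cV[R]_m}.
Context {g : 'cV[R]_nx -> 'cV[R]_ny -> 'cV[R]_nxi -> R}.
Context {Y : set 'cV[R]_ny} {Yx : 'cV[R]_nx -> set 'cV[R]_ny}.
Context {U : set 'cV[R]_nxi} (x : 'cV[R]_nx) {L : R}.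
Hypotheses (A_affine : is_affine A) (B_affine : is_affine B).
Hypothesis (h_affine : is_affine h).
Hypothesis Y_finite : finite_set Y.
Hypothesis Yx_sub : Yx x `<=` Y.
Hypothesis g_continuous : forall y, Y y -> {within U, continuous (g x y)}.
Hypothesis g_concave : forall y, Y y -> concave_on U (g x y).
Hypothesis L_ge0 : 0 <= L.
Hypothesis g_lipschitz : forall xi y y', U xi -> Y y -> Y y' ->
  `|g x y xi - g x y' xi| <= L * enorm (y - y').

Lemma region_adaptable (D : set 'cV[R]_nxi) (v : R) (s : nat) :
  (0 < s)%N -> (s <= nxi + 1)%N -> recourse_stable A B h Yx U x D -> D !=set0 ->
  (forall xi, D xi ->
    exists y, [/\ Yx x y, feasible A B h x y xi & g x y xi <= v]) ->
  exists z : 'I_s -> 'cV[R]_ny, (forall k, Yx x (z k)) /\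
    forall xi, U xi -> closure D xi -> exists k, feasible A B h x (z k) xi /\
      g x (z k) xi <= v + L * diam Y * ln ((nxi%:R + 1) / s%:R).
Proof.
move=> s0 sn [cD DU stable] D0 Dv; have [xi0 Dxi0] := D0.
have [sY YE] := (finite_seqP Y).1 Y_finite.
pose y (j : 'I_(size sY)) := nth 0 sY j.
have Yy j : Y (y j) by rewrite YE /=; exact: mem_nth.
pose S0 := [set j | `[< Yx x (y j) /\
  forall xi, D xi -> feasible A B h x (y j) xi >]]%SET.
pose f j xi := g x (y j) xi - v.
have cf j : concave_on D (f j).
  apply/concave_onP => u w a b Du Dw a0 b0 ab.
  have /concave_onP/(_ u w a b (DU _ Du) (DU _ Dw) a0 b0 ab) := g_concave _ (Yy j).
  rewrite -(lerD2r (- v)); apply: le_trans.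
  by rewrite -[v in leRHS]mul1r -ab /f le_eqVlt; apply/orP; left; apply/eqP; ring.
have Df xi : D xi -> exists2 j, j \in S0 & f j xi <= 0.
  move=> Dxi; have [y' [Yxy' fy' gy']] := Dv xi Dxi.
  have y's : y' \in sY by have := Yx_sub _ Yxy'; rewrite YE.
  have ilt : (index y' sY < size sY)%N by rewrite index_mem.
  have yE : y (Ordinal ilt) = y' by exact: nth_index.
  exists (Ordinal ilt); last by rewrite /f yE subr_le0.
  rewrite inE; apply/asboolP; rewrite yE.
  (* Feasibility at the single [xi] spreads to all of [D] by recourse stability. *)
  suff : [set y | Yx x y /\ forall xi, D xi -> feasible A B h x y xi] y' by [].
  by rewrite -stable; split=> //; exists xi.
have [|[w Hw]|S1 [S1n S1S0 H1]] := helly _ (fun j => D `&` [set xi | 0 < f j xi]) S0.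
- by move=> j; exact: convex_superlevel.
(* Since [D] is nonempty, so is [S0], and a common point really lies in [D]. *)
- have [j1 /Hw[Dw _] _] := Df xi0 Dxi0.
  have [j2 /Hw[_ /= fw]] := Df w Dw.
  by rewrite leNgt fw.
have Df1 xi : D xi -> exists2 j, j \in S1 & f j xi <= 0.
  move=> Dxi; apply: contrapT => H; apply: H1; exists xi => j jS1; split=> //=.
  by rewrite ltNge; apply/negP => fj; apply: H; exists j.
have [p1 S1p1 Hp1] := minimax _ S1 _ cD cf D0 Df1.
have f_close i j xi : D xi -> `|f i xi - f j xi| <= L * diam Y.
  move=> Dxi; rewrite /f opprB addrA subrK.
  apply: le_trans (g_lipschitz _ _ _ (DU _ Dxi) (Yy i) (Yy j)) _.
  by apply: ler_wpM2l => //; exact: enorm_le_diam.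
have S1sd : (#|S1| <= s + (nxi + 1 - s))%N by rewrite subnKC.
have [S2 [p2 [S2S1 S2s S2p2 H2]]] := sparsify _ _ _ _ f_close s _ S1 p1 s0 S1sd S1p1.
pose c := L * diam Y * ln ((nxi%:R + 1) / s%:R).
have Hp2 xi : D xi -> \sum_j p2 j * f j xi <= c.
  move=> Dxi; apply: le_trans (H2 xi Dxi) _.
  by rewrite subnKC// natrD gerDr; exact: Hp1.
have [j0 j0S2 _] := weights_on_le (f^~ xi0) _ S2p2 (Hp2 _ Dxi0).
have S2S0 j : j \in S2 -> j \in S0.
  by move=> jS2; apply: (fintype.subsetP S1S0); exact: (fintype.subsetP S2S1).
(* [S2] may have fewer than [s] elements; the default [j0] fills the remaining places, repetitions
   being allowed. *)
exists (fun k => y (nth j0 (enum S2) k)); split.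
  move=> k; suff /S2S0 : nth j0 (enum S2) k \in S2 by rewrite inE => /asboolP[].
  have [kS2|kS2] := ltnP k (size (enum S2)); first by rewrite -mem_enum mem_nth.
  by rewrite nth_default.
move=> xi Uxi Dxi.
(* The bound on the weighted sum is what passes to the closure; a decision is extracted only
   afterwards, since it depends on [xi]. *)
have f_cont j : {within U, continuous (f j)}.
  by move=> t; apply: continuousB; [exact: g_continuous|exact: cst_continuous].
have sum_cont := within_continuous_sum _ _ p2 f_cont.
have := within_continuous_le_closure _ _ _ _ sum_cont DU Hp2 _ Uxi Dxi.
move=> /(weights_on_le (f^~ xi) _ S2p2)[j jS2 fj].
have jk : (index j (enum S2) < s)%N.
  by apply: leq_trans S2s; rewrite cardE index_mem mem_enum.
exists (Ordinal jk); rewrite /= nth_index ?mem_enum//; split; last first.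
  by move: fj; rewrite /f lerBlDl.
have := S2S0 _ jS2; rewrite inE => /asboolP[_ Dfeas].
exact: feasible_closure Dfeas _ Dxi.
Qed.

End region.

(** * From single regions to the whole uncertainty set *)

Theorem theorem26 (R : realType) (nx ny nxi m : nat)
    (X : set 'cV[R]_nx) (Y : set 'cV[R]_ny) (Yx : 'cV[R]_nx -> set 'cV[R]_ny)
    (U : set 'cV[R]_nxi)
    (A : 'cV[R]_nxi -> 'M[R]_(m, nx)) (B : 'cV[R]_nxi -> 'M[R]_(m, ny))
    (h : 'cV[R]_nxi -> 'cV[R]_m)
    (g : 'cV[R]_nx -> 'cV[R]_ny -> 'cV[R]_nxi -> R) (L : R) (N : nat)
    (X_compact : compact X)
    (Y_int : forall y, Y y -> forall i, y i ord0 \is a Num.int)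
    (Y_bounded : bounded_set Y)
    (Yx_sub : forall x, X x -> Yx x `<=` Y)
    (U_nonempty : U !=set0)
    (U_convex : @convex_set R 'cV[R]_nxi U)
    (U_compact : compact U)
    (A_affine : is_affine A) (B_affine : is_affine B) (h_affine : is_affine h)
    (standing : exists x y, [/\ X x, Yx x y &
                  forall xi, U xi -> feasible A B h x y xi])
    (g_continuous :
       {within X `*` Y `*` U, continuous (fun p => g p.1.1 p.1.2 p.2)})
    (g_concave : forall x y, X x -> Y y -> concave_on U (g x y))
    (L_gt0 : 0 < L)
    (g_lipschitz : forall x xi y y', X x -> U xi -> Y y -> Y y' ->
       `|g x y xi - g x y' xi| <= L * enorm (y - y'))
    (regions : forall x, X x -> exists D : 'I_N -> set 'cV[R]_nxi,
       (forall r, recourse_stable A B h Yx U x (D r)) /\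
       \bigcup_(r in [set: 'I_N]) closure (D r) = U)
    (s : nat) (s_gt0 : (0 < s)%N) (s_le : (s <= nxi + 1)%N) :
  (opt A B h g X Yx U (N * s) - opt_2RO A B h g X Yx U
     <= (L * diam Y * ln ((nxi%:R + 1) / s%:R))%:E)%E.
Proof.
set c := L * diam Y * ln _.
have Y_finite : finite_set Y by exact: finite_bounded_int.
(* Taking [v] strictly above [opt_2RO] avoids any question of whether infima are attained; letting
   [v] decrease to [opt_2RO] gives the claim. *)
suff optv v : (opt_2RO A B h g X Yx U < v%:E)%E ->
    (opt A B h g X Yx U (N * s) <= (v + c)%:E)%E.
  case: (opt_2RO A B h g X Yx U) optv => [w| |] optv.
  - rewrite leeBlDr//; apply/lee_addgt0Pr => e e0.
    have -> : (c%:E + w%:E + e%:E = (w + e + c)%:E)%E.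
      by rewrite -!EFinD; congr _%:E; ring.
    by apply: optv; rewrite lte_fin ltrDl.
  - by rewrite addeNy leNye.
  (* In [\bar R], [-oo - -oo] is [-oo]. *)
  - suff -> : opt A B h g X Yx U (N * s) = -oo%E by rewrite addNye leNye.
    apply: eq_ninfty => r; rewrite -(subrK c r).
    by apply: optv; rewrite ltNyr.
move=> /ereal_inf_lt[_ [x Xx <-] xv].
have xi_v xi : U xi ->
    exists y, [/\ Yx x y, feasible A B h x y xi & g x y xi <= v].
  move=> Uxi; have : (ereal_inf [set cost A B h g x y xi | y in Yx x] < v%:E)%E.
    by apply: le_lt_trans xv; apply: ereal_sup_ubound; exists xi.
  move=> /ereal_inf_lt[_ [y Yxy <-]]; rewrite /cost; case: asboolP => // fy.
  by rewrite lte_fin => /ltW gv; exists y.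
have [xi0 Uxi0] := U_nonempty; have [y0 [Yxy0 _ _]] := xi_v _ Uxi0.
have [D [Dstable DU]] := regions x Xx.
have zP r : exists z : 'I_s -> 'cV[R]_ny, (forall k, Yx x (z k)) /\
    forall xi, U xi -> closure (D r) xi -> exists k,
      feasible A B h x (z k) xi /\ g x (z k) xi <= v + c.
  (* An empty region has empty closure and covers nothing, but its [s] places must still hold
     decisions from [Yx x], here [y0]. *)
  have [->|/set0P D0] := eqVneq (D r) set0.
    by exists (fun=> y0); split=> // xi _; rewrite closure0.
  apply: (region_adaptable (U := U)) => //.
  - exact: Yx_sub.
  - by move=> y Yy; exact: within_continuous_slice g_continuous Xx Yy.
  - by move=> y Yy; exact: g_concave.
  - exact: ltW.
  - by move=> xi y y' Uxi; exact: g_lipschitz.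
  - by move=> xi Dxi; apply: xi_v; case: (Dstable r) => _ /(_ _ Dxi).
have [z {}zP] := choice zP.
(* Decodes a position among the [N * s] into a region and a place within it, undoing
   [mxvec_index]. *)
pose rk (i : 'I_(N * s)) := enum_val (cast_ord (esym (mxvec_cast N s)) i).
have rkK r k : rk (mxvec_index r k) = (r, k).
  by rewrite /rk /mxvec_index cast_ordK enum_rankK.
apply: ge_ereal_inf; eexists.
  exists x, (fun i => z (rk i).1 (rk i).2); split=> // i.
  by have [] := zP (rk i).1.
apply: ge_ereal_sup => _ [xi Uxi <-].
have [r _ Dxi] : (\bigcup_(r in [set: 'I_N]) closure (D r)) xi by rewrite DU.
have [k [fk gk]] := (zP r).2 xi Uxi Dxi.
apply: ge_ereal_inf; eexists; first by exists (mxvec_index r k).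
by rewrite rkK /cost asboolT// lee_fin.
Qed.
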